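(* Let $G$ be a finite group and let $L \leq G$ be a perfect subgroup. Then $L$ is normal in $G$ if and only if the summand $A(-)[e_L^{-1}]$ inherits all norms of the form $\tilde{N}_K^H$ (with $K\leq H\leq G$) such that $K$ contains a subgroup conjugate in $G$ to $L$.
   Context: For $H \leq G$, $A(H)$ is the Burnside ring of finite $H$-sets, $R^G_H\colon A(G)\to A(H)$ is restriction, and for $K \leq H$ the norm $N_K^H \colon A(K) \to A(H)$ is the multiplicative map given on finite $K$-sets by co-induction $X \mapsto \mathrm{Map}_K(H,X)$, extended to virtual sets in the standard way (it is the norm of the Tambara functor $A(-)$). For $Q\leq G$ the mark $\phi^Q\colon A(G)\to\mathbb{Z}$ is the ring homomorphism with $\phi^Q([S])=|S^Q|$. For a finite group $Q$, $O^{\mathrm{solv}}(Q)$ is the unique minimal normal subgroup of $Q$ with solvable quotient; $Q$ is perfect iff $Q=O^{\mathrm{solv}}(Q)$. By Dress, conjugacy classes of perfect subgroups $L\le G$ correspond bijectively to primitive idempotents $e_L\in A(G)$, where $\phi^Q(e_L)=1$ if $O^{\mathrm{solv}}(Q)$ is conjugate in $G$ to $L$, and $\phi^Q(e_L)=0$ otherwise. $A(-)[e_L^{-1}]$ is the levelwise localization, with value $A(H)[R^G_H(e_L)^{-1}]$ at $H \leq G$; it is a Green ring and a summand of $A(-)$. It ''inherits the norm $\tilde N_K^H$'' (for $K\le H\le G$) if there is a map of multiplicative monoids $\tilde N_K^H\colon A(K)[e_L^{-1}]\to A(H)[e_L^{-1}]$ whose precomposition with the localization map $A(K)\to A(K)[e_L^{-1}]$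 equals $N_K^H$ followed by the localization map $A(H)\to A(H)[e_L^{-1}]$. *)

(* Defs.v *)
From HB Require Import structures.
From mathcomp Require Import boolp classical_sets.
From mathcomp Require Import all_boot all_order all_algebra all_fingroup.
From mathcomp Require Import all_solvable ring.

Set Implicit Arguments.
Unset Strict Implicit.
Unset Printing Implicit Defensive.

Import GRing.Theory.
Local Notation repr := generic_quotient.repr.
Local Open Scope ring_scope.
Local Open Scope quotient_scope.

(* The Grothendieck ring of a commutative semiring S: formal differences      *)
(* x - y, modulo (x - y = x' - y') iff x + y' + z = x' + y + z for some z.    *)
Section Grothendieck.
Variable S : comPzSemiRingType.
Implicit Types (p q r : S * S) (x y z : S).

Definition groth_rel p q := `[< exists z, p.1 + q.2 + z = q.1 + p.2 + z >].

Lemma groth_refl : reflexive groth_rel.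
Proof. by move=> p; apply/asboolP; exists 0. Qed.

Lemma groth_sym : symmetric groth_rel.
Proof.
by move=> p q; apply/asboolP/asboolP => -[z e]; exists z; rewrite e.
Qed.

Lemma groth_trans : transitive groth_rel.
Proof.
move=> q p r /asboolP[z e] /asboolP[z' e']; apply/asboolP.
exists (q.1 + q.2 + z + z').
transitivity ((p.1 + q.2 + z) + (q.1 + r.2 + z')); first by ring.
by rewrite e e'; ring.
Qed.

Canonical groth_equiv := EquivRel groth_rel groth_refl groth_sym groth_trans.

Definition groth := {eq_quot groth_rel}.
HB.instance Definition _ : EqQuotient _ groth_rel groth :=
  EqQuotient.on groth.
HB.instance Definition _ := Choice.on groth.

Definition gdiff x y : groth := \pi_groth (x, y).

Lemma gdiffP x y x' y' :
  gdiff x y = gdiff x' y' <-> exists z, x + y' + z = x' + y + z.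
Proof. by split => [/eqquotP/asboolP|?] //; apply/eqquotP/asboolP. Qed.

Lemma gdiffW (P : groth -> Prop) : (forall x y, P (gdiff x y)) -> forall a, P a.
Proof. by move=> PP; elim/quotW => -[x y]; apply: PP. Qed.

Lemma gdiff_repr (a : groth) : gdiff (repr a).1 (repr a).2 = a.
Proof. by rewrite /gdiff -surjective_pairing reprK. Qed.

Lemma groth_rel_repr p : groth_rel (repr (\pi_groth p)) p.
Proof. by case: p => x y; apply/asboolP/gdiffP; rewrite gdiff_repr. Qed.

Definition gadd (a b : groth) : groth :=
  gdiff ((repr a).1 + (repr b).1) ((repr a).2 + (repr b).2).
Definition gopp (a : groth) : groth := gdiff (repr a).2 (repr a).1.
Definition gmul (a b : groth) : groth :=
  gdiff ((repr a).1 * (repr b).1 + (repr a).2 * (repr b).2)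
        ((repr a).1 * (repr b).2 + (repr a).2 * (repr b).1).

Lemma gaddE x y x' y' :
  gadd (gdiff x y) (gdiff x' y') = gdiff (x + x') (y + y').
Proof.
apply/gdiffP.
have /gdiffP[z e] := gdiff_repr (gdiff x y).
have /gdiffP[z' e'] := gdiff_repr (gdiff x' y').
exists (z + z'); move: (repr _) (repr _) e e' => [a' b'] [a b] /= e e'.
transitivity ((a + y + z) + (a' + y' + z')); first by ring.
by rewrite e e'; ring.
Qed.

Lemma goppE x y : gopp (gdiff x y) = gdiff y x.
Proof.
apply/gdiffP; have /gdiffP[z e] := gdiff_repr (gdiff x y).
move: (repr _) e => [a b] /= e.
by exists z; rewrite [b + x]addrC -e [a + y]addrC.
Qed.

Definition gprod p q : S * S :=
  (p.1 * q.1 + p.2 * q.2, p.1 * q.2 + p.2 * q.1).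

Lemma groth_rel_prod p p' q : groth_rel p p' -> groth_rel (gprod p q) (gprod p' q).
Proof.
move=> /asboolP[z e]; apply/asboolP; exists (z * (q.1 + q.2)) => /=.
transitivity ((p.1 + p'.2 + z) * q.1 + (p'.1 + p.2 + z) * q.2); first by ring.
by rewrite {1}e -{2}e; ring.
Qed.

Lemma gprodC p q : gprod p q = gprod q p.
Proof. by rewrite /gprod; congr (_, _); ring. Qed.

Lemma gmulE x y x' y' :
  gmul (gdiff x y) (gdiff x' y') = gdiff (x * x' + y * y') (x * y' + y * x').
Proof.
set p := gprod (x, y) (repr (gdiff x' y')); apply/gdiffP.
have rp : groth_rel (gprod (repr (gdiff x y)) (repr (gdiff x' y'))) p.
  by apply: groth_rel_prod; apply: groth_rel_repr.
have: groth_rel p (gprod (x, y) (x', y')).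
  rewrite /p !(gprodC (x, y)).
  by apply: groth_rel_prod; apply: groth_rel_repr.
by move/(groth_trans rp)/asboolP.
Qed.

Fact gaddA : associative gadd.
Proof.
elim/gdiffW=> x x'; elim/gdiffW=> y y'; elim/gdiffW=> z z'.
by rewrite !gaddE !addrA.
Qed.

Fact gaddC : commutative gadd.
Proof.
elim/gdiffW=> x x'; elim/gdiffW=> y y'.
by rewrite !gaddE addrC [x' + _]addrC.
Qed.

Fact gadd0 : left_id (gdiff 0 0) gadd.
Proof. by elim/gdiffW=> x x'; rewrite gaddE !add0r. Qed.

Fact gaddN : left_inverse (gdiff 0 0) gopp gadd.
Proof.
elim/gdiffW=> x x'; rewrite goppE gaddE; apply/gdiffP.
by exists 0; rewrite !addr0 add0r addrC.
Qed.

HB.instance Definition _ := GRing.isZmodule.Build groth gaddA gaddC gadd0 gaddN.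

Fact gmulA : associative gmul.
Proof.
elim/gdiffW=> x x'; elim/gdiffW=> y y'; elim/gdiffW=> z z'.
by rewrite !gmulE; congr gdiff; ring.
Qed.

Fact gmulC : commutative gmul.
Proof.
elim/gdiffW=> x x'; elim/gdiffW=> y y'.
by rewrite !gmulE; congr gdiff; ring.
Qed.

Fact gmul1 : left_id (gdiff 1 0) gmul.
Proof. by elim/gdiffW=> x x'; rewrite gmulE; congr gdiff; ring. Qed.

Fact gmulD : left_distributive gmul gadd.
Proof.
elim/gdiffW=> x x'; elim/gdiffW=> y y'; elim/gdiffW=> z z'.
by rewrite !(gmulE, gaddE); congr gdiff; ring.
Qed.

HB.instance Definition _ :=
  GRing.Zmodule_isComPzRing.Build groth gmulA gmulC gmul1 gmulD.

Definition togroth x : groth := gdiff x 0.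

(* The additive extension to groth S of an additive map on S. *)
Definition groth_ext (V : zmodType) (f : S -> V) (a : groth) : V :=
  f (repr a).1 - f (repr a).2.

Lemma groth_extE (V : zmodType) (f : S -> V) x y :
  {morph f : x y / x + y} -> groth_ext f (gdiff x y) = f x - f y.
Proof.
move=> fD; rewrite /groth_ext.
have /gdiffP[z] := gdiff_repr (gdiff x y).
move: (repr _) => [a b] /= /(congr1 f); rewrite !fD => /addIr e.
by apply/eqP; rewrite subr_eq addrAC -e addrK.
Qed.

End Grothendieck.

(* The localization A[s^-1]: fractions a / s^m, where a / s^m = b / s^n iff   *)
(* s^k s^n a = s^k s^m b for some k. It is the zero ring if s is nilpotent.   *)
Section Localization.
Variables (A : comPzRingType) (s : A).
Implicit Types (p q : A * nat) (a b : A) (m n : nat).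

Definition loc_rel p q :=
  `[< exists k, s ^+ (k + q.2) * p.1 = s ^+ (k + p.2) * q.1 >].

Lemma loc_refl : reflexive loc_rel.
Proof. by move=> p; apply/asboolP; exists 0. Qed.

Lemma loc_sym : symmetric loc_rel.
Proof.
by move=> p q; apply/asboolP/asboolP => -[z e]; exists z; rewrite e.
Qed.

Lemma loc_trans : transitive loc_rel.
Proof.
move=> [b n] [a m] [c l] /asboolP[k /= e] /asboolP[k' /= e']; apply/asboolP.
exists (k + k' + n)%N => /=.
transitivity (s ^+ (k' + l) * (s ^+ (k + n) * a)); first by rewrite ?exprD; ring.
rewrite e; transitivity (s ^+ (k + m) * (s ^+ (k' + l) * b)); first by rewrite ?exprD; ring.
by rewrite e'; rewrite ?exprD; ring.
Qed.

Canonical loc_equiv := EquivRel loc_rel loc_refl loc_sym loc_trans.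

Definition loc := {eq_quot loc_rel}.
HB.instance Definition _ : EqQuotient _ loc_rel loc := EqQuotient.on loc.
HB.instance Definition _ := Choice.on loc.

Definition lfrac a m : loc := \pi_loc (a, m).

Lemma lfracP a m b n : lfrac a m = lfrac b n <->
  exists k, s ^+ (k + n) * a = s ^+ (k + m) * b.
Proof. by split => [/eqquotP/asboolP|?] //; apply/eqquotP/asboolP. Qed.

Lemma lfracW (P : loc -> Prop) : (forall a m, P (lfrac a m)) -> forall u, P u.
Proof. by move=> PP; elim/quotW => -[a m]; apply: PP. Qed.

Lemma lfrac_repr (u : loc) : lfrac (repr u).1 (repr u).2 = u.
Proof. by rewrite /lfrac -surjective_pairing reprK. Qed.

Definition ladd (u v : loc) : loc :=
  lfrac (s ^+ (repr v).2 * (repr u).1 + s ^+ (repr u).2 * (repr v).1)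
        ((repr u).2 + (repr v).2).
Definition lopp (u : loc) : loc := lfrac (- (repr u).1) (repr u).2.
Definition lmul (u v : loc) : loc :=
  lfrac ((repr u).1 * (repr v).1) ((repr u).2 + (repr v).2).

Lemma laddE a m b n :
  ladd (lfrac a m) (lfrac b n) = lfrac (s ^+ n * a + s ^+ m * b) (m + n).
Proof.
apply/lfracP.
have /lfracP[k e] := lfrac_repr (lfrac a m).
have /lfracP[k' e'] := lfrac_repr (lfrac b n).
move: (repr _) (repr _) e e' => [b1 n1] [a1 m1] /= e e'.
exists (k + k')%N.
transitivity (s ^+ (k' + n1 + n) * (s ^+ (k + m) * a1) +
              s ^+ (k + m1 + m) * (s ^+ (k' + n) * b1)); first by rewrite ?exprD; ring.
by rewrite e e'; rewrite ?exprD; ring.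
Qed.

Lemma loppE a m : lopp (lfrac a m) = lfrac (- a) m.
Proof.
apply/lfracP; have /lfracP[k e] := lfrac_repr (lfrac a m).
by exists k; rewrite !mulrN e.
Qed.

Lemma lmulE a m b n : lmul (lfrac a m) (lfrac b n) = lfrac (a * b) (m + n).
Proof.
apply/lfracP.
have /lfracP[k e] := lfrac_repr (lfrac a m).
have /lfracP[k' e'] := lfrac_repr (lfrac b n).
move: (repr _) (repr _) e e' => [b1 n1] [a1 m1] /= e e'.
exists (k + k')%N.
transitivity ((s ^+ (k + m) * a1) * (s ^+ (k' + n) * b1)); first by rewrite ?exprD; ring.
by rewrite e e'; rewrite ?exprD; ring.
Qed.

Fact laddA : associative ladd.
Proof.
elim/lfracW=> a m; elim/lfracW=> b n; elim/lfracW=> c l.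
by rewrite !laddE; congr lfrac; [rewrite ?exprD; ring | rewrite addnA].
Qed.

Fact laddC : commutative ladd.
Proof.
elim/lfracW=> a m; elim/lfracW=> b n.
by rewrite !laddE addrC addnC.
Qed.

Fact ladd0 : left_id (lfrac 0 0) ladd.
Proof. by elim/lfracW=> a m; rewrite laddE add0n; congr lfrac; rewrite ?exprD; ring. Qed.

Fact laddN : left_inverse (lfrac 0 0) lopp ladd.
Proof.
elim/lfracW=> a m; rewrite loppE laddE; apply/lfracP.
by exists 0%N; rewrite ?exprD; ring.
Qed.

HB.instance Definition _ := GRing.isZmodule.Build loc laddA laddC ladd0 laddN.

Fact lmulA : associative lmul.
Proof.
elim/lfracW=> a m; elim/lfracW=> b n; elim/lfracW=> c l.
by rewrite !lmulE mulrA addnA.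
Qed.

Fact lmulC : commutative lmul.
Proof.
elim/lfracW=> a m; elim/lfracW=> b n.
by rewrite !lmulE mulrC addnC.
Qed.

Fact lmul1 : left_id (lfrac 1 0) lmul.
Proof. by elim/lfracW=> a m; rewrite lmulE mul1r. Qed.

Fact lmulD : left_distributive lmul ladd.
Proof.
elim/lfracW=> a m; elim/lfracW=> b n; elim/lfracW=> c l.
rewrite !(lmulE, laddE); apply/lfracP; exists 0%N; rewrite ?exprD; ring.
Qed.

HB.instance Definition _ :=
  GRing.Zmodule_isComPzRing.Build loc lmulA lmulC lmul1 lmulD.

Definition toloc a : loc := lfrac a 0.

End Localization.

(* Finite H-sets. MathComp actions are right actions; x . a = a^-1 x          *)
(* identifies them with left H-sets. Only the values at a in H matter.        *)
Section FiniteSets.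
Variables (gT : finGroupType) (H : {group gT}).

Definition hset_iso (T U : Type) (to : action H T) (uo : action H U) :=
  exists2 f : T -> U, bijective f &
    forall x a, a \in H -> f (to x a) = uo (f x) a.

Lemma hset_iso_refl T (to : action H T) : hset_iso to to.
Proof. by exists id => //; exists id. Qed.

Lemma hset_iso_sym T U (to : action H T) (uo : action H U) :
  hset_iso to uo -> hset_iso uo to.
Proof.
case=> f [g fK gK] fE; exists g; first by exists f.
by move=> x a Ha; rewrite -{1}[x]gK -fE // fK.
Qed.

Lemma hset_iso_trans T U V (to : action H T) (uo : action H U)
    (vo : action H V) :
  hset_iso to uo -> hset_iso uo vo -> hset_iso to vo.
Proof.
case=> f bf fE [g bg gE]; exists (g \o f); first exact: bij_comp.
by move=> x a Ha; rewrite /= fE ?gE.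
Qed.

Section Transport.
Variables (T : finType) (to : action H T).

Definition ordact (i : 'I_#|T|) a := enum_rank (to (enum_val i) a).

Fact ordact_is_action : is_action H ordact.
Proof.
split=> [a i j e | i a b Ha Hb].
  exact/enum_val_inj/(@act_inj _ _ _ to a)/enum_rank_inj.
by rewrite /ordact enum_rankK actMin.
Qed.

Definition ord_action : action H 'I_#|T| := Action ordact_is_action.

Lemma ord_action_iso : hset_iso to ord_action.
Proof.
exists enum_rank; first exact: enum_rank_bij.
by move=> x a _; rewrite /= /ordact enum_rankK.
Qed.

End Transport.

Definition triv_act (T : Type) (x : T) (a : gT) := x.

Fact triv_act_is_action T : is_action H (@triv_act T).
Proof. by split=> [a x y e|]; first exact: e. Qed.

Definition triv_action T : action H T := Action (@triv_act_is_action T).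

Section Binary.
Variables (T U : finType) (to : action H T) (uo : action H U).

Definition sum_act (z : T + U) a : T + U :=
  match z with inl x => inl (to x a) | inr y => inr (uo y a) end.

Fact sum_act_is_action : is_action H sum_act.
Proof.
split=> [a [x|y] [x'|y'] //= [] | [x|y] a b Ha Hb] /=; rewrite ?actMin //.
  by move/(@act_inj _ _ _ to)->.
by move/(@act_inj _ _ _ uo)->.
Qed.

Definition sum_action := Action sum_act_is_action.

Definition prod_act (z : T * U) a : T * U := (to z.1 a, uo z.2 a).

Fact prod_act_is_action : is_action H prod_act.
Proof.
split=> [a [x y] [x' y'] [] | [x y] a b Ha Hb].
  by move=> /(@act_inj _ _ _ to)-> /(@act_inj _ _ _ uo)->.
by rewrite /prod_act !actMin.
Qed.

Definition prod_action := Action prod_act_is_action.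

End Binary.

Lemma sum_action_iso (T T' U U' : finType) (to : action H T) (to' : action H T')
    (uo : action H U) (uo' : action H U') :
  hset_iso to to' -> hset_iso uo uo' ->
  hset_iso (sum_action to uo) (sum_action to' uo').
Proof.
case=> f [f' fK f'K] fE [g [g' gK g'K] gE].
exists (fun z => match z with inl x => inl (f x) | inr y => inr (g y) end).
  exists (fun z => match z with inl x => inl (f' x) | inr y => inr (g' y) end).
    by case=> x; rewrite ?fK ?gK.
  by case=> x; rewrite ?f'K ?g'K.
by case=> x a Ha /=; rewrite ?fE ?gE.
Qed.

Lemma prod_action_iso (T T' U U' : finType) (to : action H T) (to' : action H T')
    (uo : action H U) (uo' : action H U') :
  hset_iso to to' -> hset_iso uo uo' ->
  hset_iso (prod_action to uo) (prod_action to' uo').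
Proof.
case=> f [f' fK f'K] fE [g [g' gK g'K] gE].
exists (fun z => (f z.1, g z.2)); last by move=> z a Ha /=; rewrite fE ?gE.
by exists (fun z => (f' z.1, g' z.2)) => -[x y] /=; rewrite ?fK ?gK ?f'K ?g'K.
Qed.

(* Every finite H-set is isomorphic to one with carrier an ordinal.           *)
Definition hset := {n : nat & action H 'I_n}.
HB.instance Definition _ := gen_eqMixin hset.
HB.instance Definition _ := gen_choiceMixin hset.

Definition hset_act (X : hset) : action H 'I_(tag X) := tagged X.

Definition hset_rel (X Y : hset) := `[< hset_iso (hset_act X) (hset_act Y) >].

Lemma hset_rel_refl : reflexive hset_rel.
Proof. by move=> X; apply/asboolP/hset_iso_refl. Qed.

Lemma hset_rel_sym : symmetric hset_rel.
Proof. by move=> X Y; apply/asboolP/asboolP; apply: hset_iso_sym. Qed.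

Lemma hset_rel_trans : transitive hset_rel.
Proof.
by move=> Y X Z /asboolP XY /asboolP YZ; apply/asboolP/(hset_iso_trans XY YZ).
Qed.

Canonical hset_equiv :=
  EquivRel hset_rel hset_rel_refl hset_rel_sym hset_rel_trans.

Definition hclass := {eq_quot hset_rel}.
HB.instance Definition _ : EqQuotient _ hset_rel hclass :=
  EqQuotient.on hclass.
HB.instance Definition _ := Choice.on hclass.

Definition hclass_of (T : finType) (to : action H T) : hclass :=
  \pi_hclass (Tagged (fun n => action H 'I_n) (ord_action to)).

Definition hclass_act (x : hclass) := hset_act (repr x).

Lemma hclassP (T U : finType) (to : action H T) (uo : action H U) :
  hclass_of to = hclass_of uo <-> hset_iso to uo.
Proof.
have [tI uI] := (ord_action_iso to, ord_action_iso uo).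
split=> [/eqquotP/asboolP e | e].
  by apply: hset_iso_trans tI _; apply: hset_iso_trans e (hset_iso_sym uI).
apply/eqquotP/asboolP; apply: hset_iso_trans (hset_iso_sym tI) _.
exact: hset_iso_trans e uI.
Qed.

Lemma hclass_actK x : hclass_of (hclass_act x) = x.
Proof.
rewrite -[RHS]reprK; apply/eqquotP/asboolP.
exact/hset_iso_sym/ord_action_iso.
Qed.

Lemma hclass_act_iso (T : finType) (to : action H T) :
  hset_iso (hclass_act (hclass_of to)) to.
Proof. by apply/hclassP; rewrite hclass_actK. Qed.

Lemma hclassW (P : hclass -> Prop) :
  (forall (T : finType) (to : action H T), P (hclass_of to)) -> forall x, P x.
Proof. by move=> PP x; rewrite -[x]hclass_actK. Qed.

Definition hadd (x y : hclass) : hclass :=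
  hclass_of (sum_action (hclass_act x) (hclass_act y)).
Definition hmul (x y : hclass) : hclass :=
  hclass_of (prod_action (hclass_act x) (hclass_act y)).
Definition hzero : hclass := hclass_of (triv_action void).
Definition hone : hclass := hclass_of (triv_action unit).

Lemma haddE (T U : finType) (to : action H T) (uo : action H U) :
  hadd (hclass_of to) (hclass_of uo) = hclass_of (sum_action to uo).
Proof. by apply/hclassP/sum_action_iso; apply: hclass_act_iso. Qed.

Lemma hmulE (T U : finType) (to : action H T) (uo : action H U) :
  hmul (hclass_of to) (hclass_of uo) = hclass_of (prod_action to uo).
Proof. by apply/hclassP/prod_action_iso; apply: hclass_act_iso. Qed.

Fact haddA : associative hadd.
Proof.
elim/hclassW=> T to; elim/hclassW=> U uo; elim/hclassW=> V vo.
rewrite !haddE; apply/hclassP.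
exists (fun z => match z with inl x => inl (inl x) | inr (inl y) => inl (inr y)
                 | inr (inr t) => inr t end); last by case=> [x|[x|x]].
exists (fun z => match z with inl (inl x) => inl x | inl (inr y) => inr (inl y)
                 | inr t => inr (inr t) end); first by case=> [x|[x|x]].
by case=> [[x|x]|x].
Qed.

Fact haddC : commutative hadd.
Proof.
elim/hclassW=> T to; elim/hclassW=> U uo; rewrite !haddE; apply/hclassP.
exists (fun z => match z with inl x => inr x | inr y => inl y end).
  by exists (fun z => match z with inl x => inr x | inr y => inl y end); case.
by case.
Qed.

Fact hadd0 : left_id hzero hadd.
Proof.
elim/hclassW=> T to; rewrite haddE; apply/hclassP.
exists (fun z : void + T => match z with inl v => of_void T v | inr x => x end).
  by exists inr => // -[].
by case=> [[]|x].
Qed.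

HB.instance Definition _ := GRing.isNmodule.Build hclass haddA haddC hadd0.

Fact hmulA : associative hmul.
Proof.
elim/hclassW=> T to; elim/hclassW=> U uo; elim/hclassW=> V vo.
rewrite !hmulE; apply/hclassP.
exists (fun z => (z.1, z.2.1, z.2.2)) => //.
by exists (fun z => (z.1.1, (z.1.2, z.2))); [case=> ? [] | case=> -[]].
Qed.

Fact hmulC : commutative hmul.
Proof.
elim/hclassW=> T to; elim/hclassW=> U uo; rewrite !hmulE; apply/hclassP.
exists (fun z => (z.2, z.1)) => //.
by exists (fun z => (z.2, z.1)); case.
Qed.

Fact hmul1 : left_id hone hmul.
Proof.
elim/hclassW=> T to; rewrite hmulE; apply/hclassP.
by exists snd => //; exists (pair tt) => // -[[]].
Qed.

Fact hmulD : left_distributive hmul hadd.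
Proof.
elim/hclassW=> T to; elim/hclassW=> U uo; elim/hclassW=> V vo.
rewrite !(haddE, hmulE); apply/hclassP.
exists (fun z => match z.1 with inl x => inl (x, z.2) | inr y => inr (y, z.2) end);
  last by case=> [[x|x] v].
exists (fun z => match z with inl x => (inl x.1, x.2) | inr y => (inr y.1, y.2) end).
  by case=> [[x|x] v].
by case=> -[].
Qed.

Fact hmul0 : left_zero hzero hmul.
Proof.
elim/hclassW=> T to; rewrite hmulE; apply/hclassP.
by exists fst; [exists (fun v : void => match v with end) => [[[]]|[]] | case=> -[]].
Qed.

HB.instance Definition _ := GRing.Nmodule_isComPzSemiRing.Build hclass
  hmulA hmulC hmul1 hmulD hmul0.

Definition burnside := groth hclass.
HB.instance Definition _ := GRing.ComPzRing.on burnside.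

Definition bclass (T : finType) (to : action H T) : burnside :=
  togroth (hclass_of to).

Definition mark (Q : {group gT}) : burnside -> int :=
  groth_ext (fun x : hclass => let to := hclass_act x in #|'Fix_to(Q)%g|%:Z).

End FiniteSets.

Section Restriction.
Variables (gT : finGroupType) (K H : {group gT}).

Definition res (sKH : K \subset H) : burnside H -> burnside K :=
  groth_ext (fun x : hclass H => bclass (hclass_act x \ sKH)).

(* Map_K(H, T), for the right K-action to on T: the maps f : H -> T such that *)
(* f (x k) = f x . k for k in K, on which H acts by (f . a) x = f (a x).      *)
Section Coinduction.
Variables (T : finType) (to : action K T).

Definition equivariant (f : {ffun subg_of H -> T}) :=
  [forall x, forall k in K, f (x * subg H k)%g == to (f x) k].

Definition coind := {f | equivariant f}.

Fact coind_act_subproof (f : coind) (a : gT) :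
  equivariant [ffun x => val f (subg H a * x)%g].
Proof.
apply/forallP=> x; apply/forall_inP=> k Kk; rewrite !ffunE mulgA.
exact: (forall_inP (forallP (valP f) _)).
Qed.

Definition coind_act (f : coind) a : coind := Sub _ (coind_act_subproof f a).

Fact coind_act_is_action : is_action H coind_act.
Proof.
split=> [a f g /(congr1 val)/ffunP fg | f a b Ha Hb].
  apply/val_inj/ffunP=> x.
  by have := fg ((subg H a)^-1 * x)%g; rewrite !ffunE mulKVg.
by apply/val_inj/ffunP=> x; rewrite !ffunE subgM // mulgA.
Qed.

Definition coind_action : action H coind := Action coind_act_is_action.

End Coinduction.

End Restriction.

Section Norm.

(* A map is polynomial of degree < n if all its n-fold deviations vanish.     *)
Definition deviation (A B : zmodType) (b : A) (f : A -> B) (a : A) : B :=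
  f (a + b) - f a.

Definition polynomial_map (A B : zmodType) (f : A -> B) :=
  exists n, forall s : seq A, size s = n ->
    forall a, foldr (@deviation A B) f s a = 0.

Variables (gT : finGroupType) (K H : {group gT}).

(* The extension of coinduction to virtual K-sets: by theorems of Dress and   *)
(* Tambara, when K is a subgroup of H, exactly one N satisfies is_norm; it    *)
(* is the norm of the Burnside Tambara functor. The value fun=> 0 is only     *)
(* the formal default of xget.                                                *)
Definition is_norm (N : burnside K -> burnside H) :=
  [/\ GRing.monoid_morphism N, polynomial_map N &
      forall (T : finType) (to : action K T),
        N (bclass to) = bclass (coind_action H to)].

Definition norm : burnside K -> burnside H := xget (fun=> 0) is_norm.

End Norm.

Section Dress.
Variable gT : finGroupType.
Implicit Types G L Q : {group gT}.

(* Normal subgroups with solvable quotient are closed under intersection, so  *)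
(* this is the smallest of them.                                              *)
Definition Osolv Q : {set gT} :=
  (\bigcap_(N : {group gT} | (N <| Q) && solvable (Q / N)) N)%g.

Definition perfect L := Osolv L == L.

Definition is_dress_idem G L (e : burnside G) :=
  forall Q, Q \subset G -> mark Q e = (Osolv Q \in (L :^: G)%g)%:R.

(* Such an idempotent exists (Dress) and is unique, since marks separate the  *)
(* elements of the Burnside ring; 0 is only the formal default of xget.       *)
Definition dress_idem G L : burnside G := xget 0 (@is_dress_idem G L).

Definition inherits_norm G L (K H : {group gT})
    (sKH : K \subset H) (sHG : H \subset G) :=
  exists Nt : loc (res (subset_trans sKH sHG) (dress_idem G L)) ->
              loc (res sHG (dress_idem G L)),
    GRing.monoid_morphism Nt /\
    forall a : burnside K, Nt (toloc _ a) = toloc _ (norm H a).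

End Dress.

(* Main.v *)
Require Import Defs.
From mathcomp Require Import boolp classical_sets.
From mathcomp Require Import all_boot all_algebra all_fingroup.
From mathcomp Require Import all_solvable ring.

(** Marks embed the Burnside ring A(H) into the ring of integer-valued
functions on subgroups, invariant under conjugation, so everything is computed
with marks.  Let e be the idempotent of L.

As a monoid under multiplication, A(K)[e^-1] is the localization of A(K) at e.
Hence a multiplicative map N from A(K) descends to A(K)[e^-1] -> A(H)[e^-1]
exactly when N(e) becomes a unit in A(H)[e^-1] ([loc_monoid_ext],
[loc_monoid_ext_unit]).  For the norm, the mark of N(a) at Q is the product of
the marks of a at the subgroups K :&: Q :^ d, where d runs over representatives
of the double cosets Q \ H / K ([mark_norm]).

Suppose that L is normal and contained in K, and that e has mark 1 at Q, so that
L is the solvable residual of Q.  Then every Q :^ d contains L with solvable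
quotient, and so does K :&: Q :^ d; thus N(e) has mark 1 wherever e has mark 1, that is
N(e) * e = e, and the norm descends.  Conversely take K = L and H = G.  If N(e)
is a unit after inverting e, its mark at L is invertible, so every
L :&: L :^ d has a conjugate of L as a subgroup, and comparing orders gives
L :^ d = L: the group L is normal.

The norm on virtual sets and the idempotent e both come from one existence
statement, [mark_realize]: a function c on subgroups, invariant under
conjugation, is the mark function of an element of A(G) as soon as, for all Q,
the order of N_G(Q) divides the sum of c(<Q, x>) over x in N_G(Q).  For e, the
function c does not distinguish Q from <Q, x>, since the quotient is cyclic.
For the norm of a = X - Y, adding a multiple of #|H| Y turns a into an actual
K-set and changes the product of marks by a multiple of #|H|, so the congruences
for N(a) follow from those for a coinduced H-set.  The product formula then
holds for any polynomial extension of coinduction, because a polynomial map that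
vanishes on actual sets vanishes on virtual ones ([degree_lt_groth]). *)

Set Implicit Arguments.
Unset Strict Implicit.
Unset Printing Implicit Defensive.

Import GRing.Theory.
Local Open Scope group_scope.

(** * The solvable residual *)

Section Perfect.
Variable gT : finGroupType.
Implicit Types G H K L P Q R : {group gT}.

(** The derived series of Q becomes constant.  Its last term D has solvable
quotient, and it lies in each normal N with solvable quotient because some
derived subgroup of Q does. *)
Lemma Osolv_stable_der Q : exists2 n, Osolv Q = Q^`(n) & Q^`(n.+1) = Q^`(n).
Proof.
have [n stab] : exists n, Q^`(n.+1) = Q^`(n).
  have [//|nstab] := pselect (exists n, Q^`(n.+1) = Q^`(n)).
  have small n : (#|Q^`(n)| + n <= #|Q|)%N.
    elim: n => [|n IHn]; first by rewrite addn0 derg0.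
    apply: leq_trans IHn; rewrite addnS ltn_add2r proper_card // properEneq.
    by rewrite der_subS andbT; apply/eqP=> e; apply: nstab; exists n.
  by have := small #|Q|.+1; rewrite leqNgt addnS ltnS leq_addl.
exists n => //; apply/eqP; rewrite eqEsubset; apply/andP; split.
  rewrite /Osolv (bigcap_min (Q^`(n))%G) // der_normal; apply/derivedP; exists n.
  by rewrite -quotient_der ?der_norm // trivg_quotient.
apply/bigcapsP=> N /andP[nsNQ /derivedP[m QN]].
have sub k : Q^`(n) \subset Q^`(k).
  elim: k => [|k IHk]; first exact: der_sub.
  by rewrite -stab !dergSn commgSS.
apply: subset_trans (sub m) _.
rewrite -quotient_sub1 ?(subset_trans (der_sub _ _)) ?normal_norm //.
by rewrite quotient_der ?normal_norm // QN.
Qed.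

Lemma Osolv_group_set Q : group_set (Osolv Q).
Proof. by have [n -> _] := Osolv_stable_der Q; apply: groupP. Qed.
Canonical Osolv_group Q := Group (Osolv_group_set Q).

Lemma Osolv_perfect Q : Osolv Q \subset [~: Osolv Q, Osolv Q].
Proof. by have [n -> stab] := Osolv_stable_der Q; rewrite -dergSn stab. Qed.

Lemma Osolv_sub Q : Osolv Q \subset Q.
Proof. by have [n -> _] := Osolv_stable_der Q; apply: der_sub. Qed.

(** Together with [Osolv_perfect] and [Osolv_sub], this says that the solvable
residual is the largest subgroup equal to its own derived subgroup, a
description that involves no quotient. *)
Lemma Osolv_max Q P : P \subset Q -> P \subset [~: P, P] -> P \subset Osolv Q.
Proof.
have [n -> _] := Osolv_stable_der Q => sPQ pP.
elim: n => [//|n IHn]; apply: subset_trans pP _.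
by rewrite dergSn commgSS.
Qed.

Lemma OsolvJ Q x : Osolv (Q :^ x)%G = Osolv Q :^ x.
Proof.
have sub R y : Osolv R :^ y \subset Osolv (R :^ y)%G.
  apply: (@Osolv_max (R :^ y)%G (Osolv_group R :^ y)%G).
    by rewrite conjSg Osolv_sub.
  by rewrite /= -conjsRg conjSg Osolv_perfect.
apply/eqP; rewrite eqEsubset sub andbT -sub_conjgV.
suff e: ((Q :^ x) :^ x^-1)%G = Q by rewrite -[X in _ \subset Osolv X]e sub.
by apply: group_inj; rewrite /= conjsgK.
Qed.

Lemma Osolv_solvable_ext Q R : Q <| R -> solvable (R / Q) -> Osolv R = Osolv Q.
Proof.
move=> nQR sol; apply/eqP; rewrite eqEsubset !Osolv_max ?Osolv_perfect //=.
  exact: subset_trans (Osolv_sub Q) (normal_sub nQR).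
by rewrite /Osolv (bigcap_min Q) // nQR.
Qed.

(** This is what makes the mark function of the idempotent of L satisfy the
congruences of [mark_realize]. *)
Lemma Osolv_joing_cycle Q x : x \in 'N(Q) -> Osolv (Q <*> <[x]>)%G = Osolv Q.
Proof.
move=> nQx; have sxN : <[x]> \subset 'N(Q) by rewrite cycle_subG.
apply: Osolv_solvable_ext; first by rewrite normalYl.
rewrite quotientYidl // abelian_sol // quotient_abelian //.
exact: cycle_abelian.
Qed.

Lemma Osolv_between P Q : Osolv Q \subset P -> P \subset Q -> Osolv P = Osolv Q.
Proof.
move=> sOP sPQ; apply/eqP; rewrite eqEsubset !Osolv_max ?Osolv_perfect //.
exact: subset_trans (Osolv_sub P) sPQ.
Qed.
End Perfect.

(** * Marks as ring homomorphisms *)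

Section Marks.
Variables (gT : finGroupType) (H : {group gT}).
Implicit Types (P Q : {group gT}) (a b : burnside H) (x y : hclass H).
Local Open Scope ring_scope.

Lemma card_afix_iso (T U : finType) (to : action H T) (uo : action H U) Q :
  Q \subset H -> hset_iso to uo -> #|'Fix_to(Q)%g| = #|'Fix_uo(Q)%g|.
Proof.
move=> sQH [f [g fK gK] fE]; rewrite -(card_imset _ (can_inj fK)).
apply: eq_card => z; apply/imsetP/afixP => [[t /afixP tQ ->] h Qh | zQ].
  by rewrite -fE ?(subsetP sQH) ?tQ.
exists (g z); rewrite ?gK //; apply/afixP=> h Qh; apply: (can_inj fK).
by rewrite fE ?(subsetP sQH) // gK zQ.
Qed.

Definition hfix Q x : nat := #|'Fix_(hclass_act x)(Q)%g|.

Lemma hfixE (T : finType) (to : action H T) Q :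
  Q \subset H -> hfix Q (hclass_of to) = #|'Fix_to(Q)%g|.
Proof. by move=> sQH; apply: card_afix_iso => //; apply: hclass_act_iso. Qed.

Lemma hfixD Q x y : Q \subset H -> hfix Q (x + y) = (hfix Q x + hfix Q y)%N.
Proof.
move=> sQH; elim/hclassW: x => T to; elim/hclassW: y => U uo.
have -> : hclass_of to + hclass_of uo = hclass_of (sum_action to uo).
  exact: haddE.
rewrite !hfixE // -(card_imset _ (@inl_inj T U)) -(card_imset _ (@inr_inj T U)).
rewrite -cardsUI [X in _ = (_ + X)%N](_ : _ = 0%N) ?addn0; last first.
  by apply: eq_card0 => z; rewrite inE; apply/andP=> -[/imsetP[? _ ->] /imsetP[]].
apply: eq_card => z; rewrite in_setU.
apply/afixP/orP => [zQ | [] /imsetP[t /afixP tQ ->] h Qh /=]; rewrite ?tQ //.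
case: z zQ => t tQ; [left | right]; apply: imset_f; apply/afixP=> h /tQ;
  by case.
Qed.

Lemma hfixM Q x y : Q \subset H -> hfix Q (x * y) = (hfix Q x * hfix Q y)%N.
Proof.
move=> sQH; elim/hclassW: x => T to; elim/hclassW: y => U uo.
have -> : hclass_of to * hclass_of uo = hclass_of (prod_action to uo).
  exact: hmulE.
rewrite !hfixE // -cardsX; apply: eq_card => -[t u]; rewrite in_setX.
apply/afixP/andP => [zQ | [/afixP tQ /afixP uQ] h Qh].
  by split; apply/afixP => h /zQ [].
by rewrite /= /prod_act /= tQ ?uQ.
Qed.

Lemma hfix1 Q : Q \subset H -> hfix Q 1 = 1%N.
Proof.
move=> sQH; have -> : 1 = hclass_of (triv_action H unit) by [].
by rewrite hfixE // (eq_card (B := predT)) ?card_unit // => z; apply/afixP.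
Qed.

Lemma hfixJ Q x h : Q \subset H -> h \in H -> hfix (Q :^ h)%G x = hfix Q x.
Proof.
move=> sQH Hh; elim/hclassW: x => T to; rewrite hfixE ?conj_subG // hfixE //.
rewrite -(card_imset 'Fix_to(Q)%g (@act_inj _ _ _ to h)).
apply: eq_card => z; apply/afixP/imsetP => [zQ | [t /afixP tQ -> k]].
  exists (to z h^-1%g); last by rewrite -actMin ?groupV // mulVg act1.
  apply/afixP=> k Qk; have Hk := subsetP sQH k Qk.
  rewrite -{2}(zQ (k ^ h)%g) ?memJ_conjg // -!actMin ?groupM ?groupV //.
  by rewrite conjgE !mulgA mulgK.
case/imsetP=> l Ql ->; have Hl := subsetP sQH l Ql.
by rewrite -actMin ?groupJ // conjgE mulKVg actMin // tQ.
Qed.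

Lemma mark_gdiff Q x y : Q \subset H ->
  mark Q (gdiff x y) = (hfix Q x)%:Z - (hfix Q y)%:Z.
Proof.
move=> sQH; rewrite /mark groth_extE // => u v.
by rewrite -PoszD -/(hfix Q (u + v)) hfixD.
Qed.

Lemma mark_bclass (T : finType) (to : action H T) Q :
  Q \subset H -> mark Q (bclass to) = #|'Fix_to(Q)%g|%:Z.
Proof.
move=> sQH; rewrite /bclass /togroth mark_gdiff // hfixE //.
have -> : hfix Q (0 : hclass H) = 0%N.
  have -> : 0 = hclass_of (triv_action H void) by [].
  by rewrite hfixE //; apply: eq_card0 => -[].
by rewrite subr0.
Qed.

Lemma markB Q : Q \subset H -> {morph @mark gT H Q : a b / a - b}.
Proof.
move=> sQH; elim/gdiffW=> x x'; elim/gdiffW=> y y'.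
have -> : gdiff x x' - gdiff y y' = gdiff (x + y') (x' + y).
  by rewrite -gaddE -(goppE y y').
by rewrite !mark_gdiff // !hfixD // !PoszD; ring.
Qed.

Lemma mark0 Q : Q \subset H -> mark Q (0 : burnside H) = 0.
Proof. by move=> sQH; rewrite -(subrr 0) markB // subrr. Qed.

Lemma markD Q : Q \subset H -> {morph @mark gT H Q : a b / a + b}.
Proof.
by move=> sQH a b; rewrite -[b]opprK markB // -[- - b]sub0r !markB // mark0 // sub0r.
Qed.

Lemma markM Q : Q \subset H -> {morph @mark gT H Q : a b / a * b}.
Proof.
move=> sQH; elim/gdiffW=> x x'; elim/gdiffW=> y y'.
have -> : gdiff x x' * gdiff y y' = gdiff (x * y + x' * y') (x * y' + x' * y).
  exact: gmulE.
by rewrite !mark_gdiff // !hfixD // !hfixM // !PoszD !PoszM; ring.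
Qed.

Lemma mark1 Q : Q \subset H -> mark Q (1 : burnside H) = 1.
Proof.
move=> sQH; have -> : (1 : burnside H) = bclass (triv_action H unit) by [].
by rewrite mark_bclass // -hfixE // hfix1.
Qed.

Lemma mark_expr Q a n : Q \subset H -> mark Q (a ^+ n) = mark Q a ^+ n.
Proof.
by move=> sQH; elim: n => [|n IHn]; rewrite ?mark1 // !exprS markM // IHn.
Qed.

Lemma mark_mulrn Q a n : Q \subset H -> mark Q (a *+ n) = n%:Z * mark Q a.
Proof.
move=> sQH; elim: n => [|n IHn]; first by rewrite mark0 // mul0r.
by rewrite mulrS markD // IHn intS mulrDl mul1r.
Qed.

Lemma mark_mulrz Q a (k : int) : Q \subset H -> mark Q (a *~ k) = k * mark Q a.
Proof.
move=> sQH; case: k => n; first by rewrite -mark_mulrn.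
by rewrite NegzE mulrNz -[- _]sub0r markB // mark0 // sub0r mark_mulrn // mulNr.
Qed.

Lemma mark_conj Q a h : Q \subset H -> h \in H ->
  mark (Q :^ h)%G a = mark Q a.
Proof.
move=> sQH Hh; elim/gdiffW: a => x y.
by rewrite !mark_gdiff ?conj_subG // !hfixJ.
Qed.

End Marks.

(** Restriction is computed on chosen representatives of the difference, and the
mark can be read off from the same ones. *)
Lemma mark_res (gT : finGroupType) (K H : {group gT}) (sKH : K \subset H)
    (Q : {group gT}) (a : burnside H) :
  Q \subset K -> mark Q (res sKH a) = mark Q a.
Proof.
move=> sQK; have sQH := subset_trans sQK sKH.
by rewrite /res /groth_ext (markB sQK) !mark_bclass // !afix_ract.
Qed.

(** * Marks separate the elements of the Burnside ring *)

Section MarksInjective.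
Variables (gT : finGroupType) (H : {group gT}).
Implicit Types (P Q : {group gT}) (a b : burnside H).

Lemma afix_astab1 (T : finType) (to : action H T) Q z :
  Q \subset H -> (z \in 'Fix_to(Q)) = (Q \subset 'C_H[z | to]).
Proof.
move=> sQH; apply/afixP/subsetP => [zQ h Qh | zQ h /zQ].
  by rewrite !inE (subsetP sQH) // sub1set inE zQ /=.
by rewrite !inE sub1set inE => /and3P[_ _ /eqP].
Qed.

Lemma eq_act_astab1 (T : finType) (to : action H T) z h k :
  h \in H -> k \in H -> (to z h == to z k) = (h * k^-1 \in 'C_H[z | to]).
Proof.
move=> Hh Hk; rewrite -(inj_eq (@act_inj _ _ _ to k^-1)) -!actMin ?groupV //.
by rewrite mulgV act1 !inE groupM ?groupV //= sub1set inE.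
Qed.

(** Orbits are matched one at a time.  A point z of A whose stabilizer is as large as possible is
matched with a point y of B: the stabilizer of z fixes some y, and by maximality
the stabilizer of y is no larger.  The orbits of z and y are then isomorphic,
and removing them preserves the hypothesis.  Working with invariant subsets of
fixed carriers avoids forming the complements as types; u0 only provides values
outside A. *)
Lemma equal_fix_iso (T U : finType) (u0 : U) (to : action H T)
    (uo : action H U) (A : {set T}) (B : {set U}) :
    {in A & H, forall z h, to z h \in A} ->
    {in B & H, forall z h, uo z h \in B} ->
    (forall Q, Q \subset H -> #|'Fix_(A | to)(Q)| = #|'Fix_(B | uo)(Q)|) ->
  exists f : T -> U, [/\ {in A &, injective f}, f @: A = B &
    {in A & H, forall z h, f (to z h) = uo (f z) h}].
Proof.
have [n leAn] := ubnP #|A|; elim: n => // n IHn in A B leAn *.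
move=> actA actB eqAB; have [A0 | [z0 Az0]] := set_0Vmem A.
  have B0 : B = set0.
    apply/eqP; rewrite -cards_eq0.
    have := eqAB 1%G (sub1G _); rewrite !afix1 !setIT => <-.
    by rewrite A0 cards0.
  exists (fun=> u0); rewrite A0 B0 imset0; split=> // z; by rewrite inE.
pose z := [arg max_(t > z0 in A) #|'C_H[t | to]|].
have [Az maxz] : z \in A /\ {in A, forall t, #|'C_H[t | to]| <= #|'C_H[z | to]|}%N.
  by rewrite /z; case: arg_maxnP.
have [y By eq_st] : exists2 y, y \in B & 'C_H[z | to] = 'C_H[y | uo].
  have sQH t : 'C_H[t | to] \subset H := subsetIl _ _.
  have sQH' u : 'C_H[u | uo] \subset H := subsetIl _ _.
  have : 0 < #|'Fix_(A | to)('C_H[z | to])|.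
    by apply/card_gt0P; exists z; rewrite inE Az afix_astab1 //=.
  rewrite (eqAB ('C_H[z | to])%G) //=.
  case/card_gt0P=> y /setIP[By]; rewrite afix_astab1 //= => szy.
  (* The stabilizer of y fixes a point of A, so maximality of z bounds it. *)
  exists y => //; apply/eqP; rewrite eqEcard szy /=.
  have : 0 < #|'Fix_(A | to)('C_H[y | uo])|.
    rewrite (eqAB ('C_H[y | uo])%G) //=; apply/card_gt0P; exists y.
    by rewrite inE By afix_astab1 //=.
  case/card_gt0P=> t /setIP[At]; rewrite afix_astab1 //= => syt.
  exact: leq_trans (subset_leq_card syt) (maxz t At).
have eq_act h k : h \in H -> k \in H -> (to z h == to z k) = (uo y h == uo y k).
  by move=> Hh Hk; rewrite !eq_act_astab1 // eq_st.
(* On the orbit of z the isomorphism g sends z h to y h; c w chooses such an h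
   with w = z h. *)
pose c w := odflt 1 [pick h in H | to z h == w].
have cP h : h \in H -> c (to z h) \in H /\ to z (c (to z h)) = to z h.
  move=> Hh; rewrite /c; case: pickP => [k /andP[Hk /eqP] | /(_ h)] //=.
  by rewrite Hh eqxx.
pose g w := uo y (c w).
have gE h : h \in H -> g (to z h) = uo y h.
  by move=> Hh; have [Hc /eqP] := cP h Hh; rewrite eq_act // => /eqP.
set O := orbit to H z; set O' := orbit uo H y.
have sOA : O \subset A by apply/subsetP=> _ /imsetP[h Hh ->]; apply: actA.
have sOB : O' \subset B by apply/subsetP=> _ /imsetP[h Hh ->]; apply: actB.
have gI : {in O &, injective g}.
  move=> _ _ /imsetP[h Hh ->] /imsetP[k Hk ->]; rewrite !gE // => /eqP.
  by rewrite -eq_act // => /eqP.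
have gA : {in O & H, forall w k, g (to w k) = uo (g w) k}.
  by move=> _ k /imsetP[h Hh ->] Hk; rewrite -actMin // !gE ?groupM // actMin.
have gO : g @: O = O'.
  apply/setP=> u; apply/imsetP/imsetP => [[_ /imsetP[h Hh ->] ->] | [h Hh ->]].
    by exists h; rewrite ?gE.
  by exists (to z h); rewrite ?gE ?imset_f.
have OA : {in O & H, forall w k, to w k \in O}.
  by move=> _ k /imsetP[h Hh ->] Hk; rewrite -actMin // imset_f ?groupM.
have OB : {in O' & H, forall w k, uo w k \in O'}.
  by move=> _ k /imsetP[h Hh ->] Hk; rewrite -actMin // imset_f ?groupM.
have eqO Q : Q \subset H -> #|'Fix_(O | to)(Q)| = #|'Fix_(O' | uo)(Q)|.
  move=> sQH; rewrite -(card_in_imset (f := g) (D := 'Fix_(O | to)(Q))); last first.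
    by move=> w v /setIP[Ow _] /setIP[Ov _]; apply: gI.
  apply: eq_card => u; apply/imsetP/setIP => [[w /setIP[Ow /afixP wQ] ->] | []].
    split; first by rewrite -gO imset_f.
    by apply/afixP=> h Qh; rewrite -gA ?wQ ?(subsetP sQH).
  rewrite -gO => /imsetP[w Ow ->] /afixP wQ; exists w => //.
  rewrite inE Ow; apply/afixP=> h Qh; have Hh := subsetP sQH h Qh.
  by apply: gI; rewrite ?OA // gA ?wQ.
have [||||f [fI fE fA]] := IHn (A :\: O) (B :\: O').
- rewrite -ltnS (leq_trans _ leAn) // ltnS proper_card // properEneq subsetDl andbT.
  apply/eqP=> /setP/(_ z); rewrite inE Az andbT /O.
  by rewrite orbit_refl.
- move=> w h /setDP[Aw Ow] Hh; rewrite inE actA // andbT.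
  by apply: contra Ow => /OA/(_ (groupVr Hh)); rewrite -actMin ?groupV // mulgV act1.
- move=> w h /setDP[Aw Ow] Hh; rewrite inE actB // andbT.
  by apply: contra Ow => /OB/(_ (groupVr Hh)); rewrite -actMin ?groupV // mulgV act1.
- move=> Q sQH; rewrite !setIDAC !cardsD eqAB //.
  by rewrite setIAC (setIidPr sOA) setIAC (setIidPr sOB) eqO.
exists (fun w => if w \in O then g w else f w); split.
- move=> w v Aw Av; case: ifP; case: ifP => Ov Ow.
  + exact: gI.
  + move=> e; have : f v \in B :\: O' by rewrite -fE imset_f // inE Ov Av.
    by rewrite -e inE -gO imset_f.
  + move=> e; have : f w \in B :\: O' by rewrite -fE imset_f // inE Ow Aw.
    by rewrite e inE -gO imset_f.
  + by apply: fI; rewrite inE ?Ow ?Ov ?Aw ?Av.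
- apply/setP=> u; apply/imsetP/idP => [[w Aw ->] | Bu].
    case: ifP => Ow; first by rewrite (subsetP sOB) // -gO imset_f.
    have : f w \in B :\: O' by rewrite -fE imset_f // inE Ow Aw.
    by case/setDP.
  have [Ou | Ou] := boolP (u \in O').
    move: Ou; rewrite -gO => /imsetP[w Ow ->]; exists w; last by rewrite Ow.
    exact: (subsetP sOA).
  have : u \in B :\: O' by rewrite inE Ou.
  by rewrite -fE => /imsetP[w /setDP[Aw Ow] ->]; exists w; rewrite ?(negPf Ow).
move=> w h Aw Hh; case: (boolP (w \in O)) => Ow; first by rewrite OA // gA.
have -> : (to w h \in O) = false.
  apply: contraNF Ow => /OA/(_ (groupVr Hh)).
  by rewrite -actMin ?groupV // mulgV act1.
by rewrite fA // inE Ow.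
Qed.

Lemma hclass_fix_inj (x y : hclass H) :
  (forall Q, Q \subset H -> hfix Q x = hfix Q y) -> x = y.
Proof.
elim/hclassW: x => T to; elim/hclassW: y => U uo eqxy; apply/hclassP.
have eqTU Q : Q \subset H -> #|'Fix_to(Q)| = #|'Fix_uo(Q)|.
  by move=> sQH; have := eqxy Q sQH; rewrite !hfixE.
have eqcard : #|T| = #|U|.
  by have := eqTU 1%G (sub1G _); rewrite !afix1 !cardsT.
have [u0 _ | U0] := pickP (@predT U); last first.
  have T0 : T -> False.
    move=> t; have : 0 < #|T| by apply/card_gt0P; exists t.
    by rewrite eqcard; case/card_gt0P=> u; have := U0 u.
  exists (fun t => False_rect U (T0 t)); last by move=> t.
  by exists (fun u => False_rect T (Bool.diff_true_false (U0 u))) => z;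
     [case: (T0 z) | have := U0 z].
have [||Q sQH|f [fI fE fA]] := @equal_fix_iso T U u0 to uo [set: T] [set: U].
- by move=> ? ? _ _; rewrite inE.
- by move=> ? ? _ _; rewrite inE.
- by rewrite !setTI eqTU.
exists f; last by move=> t h Hh; apply: fA; rewrite ?inE.
apply: inj_card_bij; last by rewrite eqcard.
by move=> t t' e; apply: fI; rewrite ?inE.
Qed.

Local Open Scope ring_scope.

Lemma mark_inj a b :
  (forall Q, Q \subset H -> mark Q a = mark Q b) -> a = b.
Proof.
elim/gdiffW: a => x x'; elim/gdiffW: b => y y' eqab.
apply/gdiffP; exists 0; rewrite !addr0; apply: hclass_fix_inj => Q sQH.
have /eqP := eqab Q sQH; rewrite !mark_gdiff // !hfixD //.
rewrite subr_eq addrAC eq_sym subr_eq -!PoszD eqz_nat => /eqP <-.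
by rewrite addnC.
Qed.
End MarksInjective.

(** * Congruences characterizing mark functions *)

Section Congruences.
Variables (gT : finGroupType) (G : {group gT}).
Implicit Types (P Q R : {group gT}) (a b : burnside G).
Local Open Scope ring_scope.

(** The usual condition sums over the quotient of the normalizer by Q; summing
over the normalizer itself multiplies both sides by the order of Q. *)
Definition burnside_congruences (c : {group gT} -> int) :=
  forall Q, Q \subset G ->
    (#|'N_G(Q)%g| %| \sum_(x in 'N_G(Q)%g) c (Q <*> <[x]>)%G)%Z.

(** By the Cauchy-Frobenius formula, the sum is the order of the normalizer times
the number of its orbits on the points fixed by Q. *)
Lemma hfix_congruence Q (x : hclass G) : Q \subset G ->
  (#|'N_G(Q)%g| %| \sum_(h in 'N_G(Q)%g) hfix (Q <*> <[h]>)%G x)%N.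
Proof.
move=> sQG; rewrite /hfix; move: (hclass_act x) => to.
have actN : [acts 'N_G(Q)%g, on 'Fix_to(Q)%g | to].
  by rewrite -{2}(setIidPr sQG) acts_subnorm_fix.
rewrite (eq_bigr (fun h => #|'Fix_('Fix_to(Q)%g | to)[h]%g|)).
  by rewrite Frobenius_Cauchy // dvdn_mull.
move=> h /setIP[Gh _]; apply: eq_card => z /=.
by rewrite afixYin ?cycle_subG // afix_cycle_in.
Qed.

Lemma mark_congruence a : burnside_congruences (fun Q => mark Q a).
Proof.
move=> Q sQG; elim/gdiffW: a => x y.
have sYG h : h \in 'N_G(Q)%g -> (Q <*> <[h]>)%G \subset G.
  by case/setIP=> Gh _; rewrite join_subG sQG cycle_subG.
rewrite (eq_bigr (fun h => (hfix (Q <*> <[h]>)%G x)%:Z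
                         - (hfix (Q <*> <[h]>)%G y)%:Z)); last first.
  by move=> h /sYG sYh; rewrite mark_gdiff.
have sumE u : \sum_(h in 'N_G(Q)%g) (hfix (Q <*> <[h]>)%G u)%:Z =
    (\sum_(h in 'N_G(Q)%g) hfix (Q <*> <[h]>)%G u)%N%:Z :> int.
  by rewrite (big_morph Posz PoszD (erefl _)).
rewrite sumrB !sumE rpredB //; exact: hfix_congruence.
Qed.

(** The action by right translation lives on the type of all subsets, the ones
that are not cosets of Q being fixed; subtracting as many copies of the trivial
one-point set leaves the class of the set of cosets. *)
Lemma mark_coset_class Q : Q \subset G -> exists b,
  forall P, P \subset G -> mark P b = #|'Fix_(rcosets Q G | 'Rs)(P)%g|%:Z.
Proof.
move=> sQG; pose to := <[actsRs_rcosets Q G]>%act.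
pose n := #|~: rcosets Q G|.
exists (bclass to - 1 *+ n) => P sPG.
rewrite markB // mark_mulrn // mark1 // mulr1 mark_bclass // /to.
rewrite afix_actby (setIidPr sPG).
have := cardsUI (~: rcosets Q G) ('Fix_(rcosets Q G | 'Rs)(P)%g).
rewrite setIA [~: _ :&: _]setIC setICr set0I cards0 addn0.
rewrite setUIr setUC setUCr setTI => ->.
by rewrite PoszD addrAC subrr add0r.
Qed.

(** Triangularity of the table of marks.  Let S be a set of subgroups, closed
under passing to subgroups of conjugates, outside which c vanishes, and let Q in
S have maximal order.  In the congruence at Q only the terms with x in Q
survive, so the index of Q in its normalizer divides c(Q).  That index is the
mark at Q of the coset set of Q; subtracting a multiple of this set removes the
conjugates of Q from S. *)
Lemma mark_realize (c : {group gT} -> int) :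
    (forall Q h, Q \subset G -> h \in G -> c (Q :^ h)%G = c Q) ->
    burnside_congruences c ->
  exists b, forall Q, Q \subset G -> mark Q b = c Q.
Proof.
move=> cJ cc.
suff main (S : {set {group gT}}) :
    {in S, forall Q, Q \subset G} ->
    (forall P Q h, Q \in S -> h \in G -> P \subset (Q :^ h)%g -> P \in S) ->
    (forall Q, Q \subset G -> Q \notin S -> c Q = 0) ->
  exists b, forall Q, Q \subset G -> mark Q b = c Q.
  apply: (main [set Q : {group gT} | Q \subset G]) => [Q|P Q h|Q sQG].
  - by rewrite inE.
  - by rewrite !inE => sQG Gh /subset_trans-> //; rewrite conj_subG.
  - by rewrite inE sQG.
have [n leSn] := ubnP #|S|; elim: n => // n IHn in c cJ cc S leSn *.
move=> SG Sdown cS; have [S0 | [Q0 SQ0]] := set_0Vmem S.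
  by exists 0 => Q sQG; rewrite mark0 // cS // S0 inE.
pose Q := [arg max_(P > Q0 in S) #|P|].
have [SQ maxQ] : Q \in S /\ {in S, forall P : {group gT}, #|P| <= #|Q|}%N.
  by rewrite /Q; case: arg_maxnP.
have sQG := SG Q SQ.
have maxS P : Q \subset P -> P \in S -> P = Q.
  move=> sQP SP; apply/group_inj/eqP; rewrite eq_sym eqEcard sQP.
  exact: maxQ.
have /dvdzP[k cQ] : (#|'N_G(Q)%g : Q|%g %| c Q)%Z.
  have := cc Q sQG; rewrite (big_setID Q%g) /= [X in _ + X]big1 ?addr0.
    rewrite (setIidPr _) ?subsetI ?sQG ?normG //.
    rewrite (eq_bigr (fun=> c Q)) => [|x Qx]; last first.
      congr c; apply/group_inj/joing_idPl.
      by rewrite cycle_subG.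
    rewrite sumr_const -(Lagrange (G := 'N_G(Q)) (H := Q)) ?subsetI ?sQG ?normG //.
    by rewrite -mulr_natl natz PoszM dvdz_mul2l // eqz_nat -lt0n cardG_gt0.
  move=> x /setDP[/setIP[Gx Nx] Qx]; apply: cS.
    by rewrite join_subG sQG cycle_subG.
  apply: contra Qx => /(maxS _ (joing_subl _ _)) <-.
  by rewrite -cycle_subG joing_subr.
have [b0 b0E] := mark_coset_class sQG.
have b0Q : mark Q b0 = #|'N_G(Q)%g : Q|%g%:Z by rewrite b0E // afixRs_rcosets.
have b0S P : P \subset G -> P \notin S -> mark P b0 = 0.
  move=> sPG SP; rewrite b0E //; congr Posz; apply: eq_card0 => A.
  apply/negbTE/negP=> /setIP[/rcosetsP[g Gg ->]].
  rewrite sub_afixRs_norms => sPQ.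
  by case/negP: SP; apply: Sdown SQ Gg sPQ.
pose c' P := c P - k * mark P b0.
pose S' := [set P in S | [forall h in G, (P :^ h)%G != Q]].
have c'J P h : P \subset G -> h \in G -> c' (P :^ h)%G = c' P.
  by move=> sPG Gh; rewrite /c' cJ // mark_conj.
have c'c : burnside_congruences c'.
  move=> P sPG; rewrite sumrB -mulr_sumr rpredB ?dvdz_mull //; first exact: cc.
  exact: mark_congruence.
have c'S P : P \subset G -> P \notin S' -> c' P = 0.
  rewrite inE negb_and /c' => sPG; case/orP=> [SP | ].
    by rewrite cS // b0S // mulr0 subr0.
  case/forall_inPn=> h Gh /negbNE/eqP PhQ.
  by rewrite -(mark_conj _ sPG Gh) -(cJ _ h) // PhQ b0Q cQ subrr.
have leS' : (#|S'| < n)%N.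
  rewrite -ltnS (leq_trans _ leSn) // ltnS proper_card //; apply/properP; split.
    by apply/subsetP=> P; rewrite inE => /andP[].
  exists Q; rewrite // inE SQ /=; apply/forall_inPn; exists 1%g => //.
  by rewrite negbK; apply/eqP/group_inj; rewrite /= conjsg1.
have S'G : {in S', forall P, P \subset G} by move=> P /setIdP[/SG].
have S'down P R h : R \in S' -> h \in G -> P \subset (R :^ h)%g -> P \in S'.
  rewrite !inE => /andP[SR nRQ] Gh sPR; rewrite (Sdown P R h) //=.
  apply/forall_inP=> g Gg; apply: contraL nRQ => /eqP PQ.
  apply/forall_inPn; exists (h * g)%g; rewrite ?groupM // negbK.
  have sQR : Q \subset (R :^ (h * g))%g by rewrite -PQ conjsgM conjSg.
  apply/eqP/group_inj/eqP; rewrite eq_sym eqEcard sQR /= cardJg.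
  exact: maxQ.
have [b bE] := IHn c' c'J c'c S' leS' S'G S'down c'S.
exists (b + b0 *~ k) => P sPG.
by rewrite markD // bE // mark_mulrz // subrK.
Qed.

End Congruences.

(** * Primitive idempotents *)

Section DressIdempotent.
Variables (gT : finGroupType) (G L : {group gT}).
Local Open Scope ring_scope.

Lemma mem_conjugatesJ (A : {set gT}) h :
  h \in G -> ((A :^ h)%g \in (L :^: G)%g) = (A \in (L :^: G)%g).
Proof.
have sub (B : {set gT}) k : k \in G -> B \in (L :^: G)%g -> (B :^ k)%g \in (L :^: G)%g.
  by move=> Gk /imsetP[g Gg ->]; rewrite -conjsgM imset_f ?groupM.
move=> Gh; apply/idP/idP => [/(sub _ _ (groupVr Gh))|]; last exact: sub.
by rewrite conjsgK.
Qed.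

Lemma dress_idemP : is_dress_idem L (dress_idem G L).
Proof.
apply: (xgetPex 0 (P := @is_dress_idem _ G L)).
pose c (Q : {group gT}) : int := (Osolv Q \in (L :^: G)%g)%:R.
have [||e eE] := @mark_realize _ G c; last by exists e => Q /eE.
  by move=> Q h sQG Gh; rewrite /c OsolvJ mem_conjugatesJ.
move=> Q sQG; rewrite (eq_bigr (fun=> c Q)).
  by rewrite sumr_const -mulr_natr natz dvdz_mull.
by move=> x /setIP[_ Nx]; rewrite /c Osolv_joing_cycle.
Qed.
End DressIdempotent.

(** * Polynomial maps *)

Section PolynomialMaps.
Local Open Scope ring_scope.
Variable A : zmodType.
Implicit Types (f g : A -> int).

Definition degree_lt (B : zmodType) n (f : A -> B) :=
  forall s : seq A, size s = n -> forall a, foldr (@deviation A B) f s a = 0.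

(** The recursion takes the innermost deviation first; iterated deviations are
written with the outermost one first. *)
Lemma degree_ltS n f :
  degree_lt n.+1 f <-> forall b, degree_lt n (deviation b f).
Proof.
split=> [fn b s sn a | fn s].
  by have := fn (rcons s b); rewrite size_rcons sn foldr_rcons => ->.
case/lastP: s => // s b; rewrite size_rcons foldr_rcons => -[sn].
exact: fn.
Qed.

Lemma foldr_deviation_comp (B C : zmodType) (h : B -> C) (f : A -> B) s a :
  {morph h : x y / x - y} ->
  foldr (@deviation A C) (fun x => h (f x)) s a =
  h (foldr (@deviation A B) f s a).
Proof.
by move=> hB; elim: s a => //= b s IHs a; rewrite /deviation !IHs hB.
Qed.

Lemma degree_lt_comp n (B C : zmodType) (h : B -> C) (f : A -> B) :
  {morph h : x y / x - y} -> degree_lt n f -> degree_lt n (fun a => h (f a)).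
Proof.
move=> hB fn s sn a; rewrite foldr_deviation_comp // fn //.
by rewrite -(subrr 0) hB subrr.
Qed.

Lemma degree_lt_lin n f g (c : int) :
  degree_lt n f -> degree_lt n g -> degree_lt n (fun a => f a + c * g a).
Proof.
elim: n f g => [|n IHn] f g fn gn.
  move=> [] // _ a /=.
  by have /= -> := fn [::] erefl a; have /= -> := gn [::] erefl a; rewrite mulr0 addr0.
apply/degree_ltS => b; have := IHn _ _ ((degree_ltS _ _).1 fn b) ((degree_ltS _ _).1 gn b).
by congr degree_lt; apply/funext=> a; rewrite /deviation; ring.
Qed.

Lemma degree_lt_le m n f : (m <= n)%N -> degree_lt m f -> degree_lt n f.
Proof.
move=> /subnK <-; elim: (n - m)%N => // k IHk /IHk fk s.
rewrite addSn; case: s => //= b s [sn] a.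
by rewrite /deviation !fk // subrr.
Qed.

(** The deviation of the product along b is
f_b(a) * g(a) + g(b) * f_b(a) + g(b) * f(a), where f_b is the deviation of f:
the first term is handled by induction, the others have the degree of f. *)
Lemma degree_lt_mul n f g : {morph g : a b / a + b} ->
  degree_lt n f -> degree_lt n.+1 (fun a => f a * g a).
Proof.
move=> gD; elim: n f => [|n IHn] f fn; apply/degree_ltS => b.
  move=> [] // _ a; have f0 x : f x = 0 by have /= -> := fn [::] erefl x.
  by rewrite /= /deviation !f0 !mul0r subrr.
have fb := (degree_ltS _ _).1 fn b.
have := degree_lt_lin (g b) (degree_lt_lin (g b) (IHn _ fb) (degree_lt_le (leqnSn n) fb)) fn.
congr degree_lt; apply/funext=> a; rewrite /deviation gD; ring.
Qed.

Lemma degree_lt_prod (I : Type) (r : seq I) (F : I -> A -> int) :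
  (forall i, {morph F i : a b / a + b}) ->
  degree_lt (size r).+1 (fun a => \prod_(i <- r) F i a).
Proof.
move=> FD; elim: r => [|i r IHr].
  apply/degree_ltS=> b [] // _ a; rewrite /= /deviation !big_nil subrr //.
have := degree_lt_mul (FD i) IHr; congr degree_lt; apply/funext=> a.
by rewrite big_cons mulrC.
Qed.
End PolynomialMaps.

(** By induction on the degree, f is invariant under adding an element of S,
hence f (x - y) = f (x - y + y) = f x = 0. *)
Lemma degree_lt_groth (S : comPzSemiRingType) n (f : groth S -> int) :
  degree_lt n f -> (forall x, f (togroth x) = 0%R) -> forall a, f a = 0%R.
Proof.
elim: n f => [|n IHn] f fn f0 a; first exact: (fn [::]).
have fb x c : f (c + togroth x)%R = f c.
  apply/eqP; rewrite -subr_eq0; apply/eqP.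
  apply: (IHn (deviation (togroth x) f)); first exact: (degree_ltS _ _).1 fn _.
  move=> y; rewrite /deviation f0.
  have -> : (togroth y + togroth x = togroth (y + x))%R.
    by rewrite /togroth -[LHS]/(gadd _ _) gaddE add0r.
  by rewrite f0 subrr.
elim/gdiffW: a => x y; rewrite -(fb y).
have -> : (gdiff x y + togroth y = togroth x)%R; last by [].
rewrite /togroth -[LHS]/(gadd _ _) gaddE; apply/gdiffP.
by exists 0%R; rewrite !addr0 addrC.
Qed.

(** * Fixed points of coinduced sets *)

Section DoubleCosets.
Variables (gT : finGroupType) (K H : {group gT}).
Implicit Types (Q : {group gT}).

Definition dcoset Q x : {set gT} := Q :* x * K.
Definition dc_rep Q x := repr (dcoset Q x).
Definition dc_reps Q := [set dc_rep Q x | x in H].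

Lemma dcosetP Q x y :
  reflect (exists q k, [/\ q \in Q, k \in K & y = q * x * k]) (y \in dcoset Q x).
Proof.
apply: (iffP mulsgP) => [[_ k /rcosetP[q Qq ->] Kk ->] | [q [k [Qq Kk ->]]]].
  by exists q, k.
by exists (q * x) k; rewrite // mem_mulg ?set11.
Qed.

Lemma dcosetM Q x q k : q \in Q -> k \in K -> dcoset Q (q * x * k) = dcoset Q x.
Proof.
move=> Qq Kk; rewrite /dcoset !rcosetM (rcoset_id Qq).
by rewrite -[LHS]mulgA (lcoset_id Kk).
Qed.

(** The representative depends on the double coset alone, being chosen from it
as a set. *)
Lemma dc_repP Q x :
  exists q k, [/\ q \in Q, k \in K & x = q * dc_rep Q x * k].
Proof.
have : dc_rep Q x \in dcoset Q x.
  by apply: (mem_repr x); apply/dcosetP; exists 1, 1; rewrite !group1 mul1g mulg1.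
case/dcosetP=> q [k [Qq Kk ->]]; exists q^-1, k^-1.
by rewrite !groupV !mulgA mulVg mul1g mulgK.
Qed.

Lemma dc_repM Q x q k : q \in Q -> k \in K -> dc_rep Q (q * x * k) = dc_rep Q x.
Proof. by move=> Qq Kk; rewrite /dc_rep dcosetM. Qed.

Lemma dc_rep_id Q x : dc_rep Q (dc_rep Q x) = dc_rep Q x.
Proof. by have [q [k [Qq Kk {2}->]]] := dc_repP Q x; rewrite dc_repM. Qed.

Hypothesis sKH : K \subset H.

Lemma dc_rep_in Q x : Q \subset H -> x \in H -> dc_rep Q x \in H.
Proof.
move=> sQH; have [q [k [Qq Kk {1}->]]] := dc_repP Q x.
by rewrite groupMr ?groupMl ?(subsetP sQH q) ?(subsetP sKH k).
Qed.

Section CoinducedFixedPoints.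
Variables (T : finType) (to : action K T) (Q : {group gT}).
Hypothesis sQH : Q \subset H.

Let ev (f : coind H to) x := val f (subg H x).

Lemma coind_evM f x k : x \in H -> k \in K -> ev f (x * k) = to (ev f x) k.
Proof.
move=> Hx Kk; rewrite /ev subgM ?(subsetP sKH k) //.
exact: (eqP (forall_inP (forallP (valP f) _) k Kk)).
Qed.

Lemma coind_ev_fixed f :
  reflect {in Q & H, forall q x, ev f (q * x) = ev f x}
          (f \in 'Fix_(coind_action H to)(Q)).
Proof.
apply: (iffP afixP) => [fQ q x Qq Hx | fQ q Qq].
  by rewrite -{2}(fQ q Qq) /ev /= ffunE subgM ?(subsetP sQH q).
apply/val_inj/ffunP=> x; rewrite ffunE.
have := fQ q (sgval x) Qq (subgP x).
by rewrite /ev subgM ?(subsetP sQH q) ?subgP // sgvalK.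
Qed.

Lemma coind_fixed_rep f x q k :
  f \in 'Fix_(coind_action H to)(Q) -> x \in H -> q \in Q -> k \in K ->
  ev f (q * x * k) = to (ev f x) k.
Proof.
move=> /coind_ev_fixed fQ Hx Qq Kk.
by rewrite coind_evM ?groupM ?(subsetP sQH q) // fQ.
Qed.

Let D := dc_reps Q.
Let F d : {set option T} :=
  if d \in D then Some @: 'Fix_to(K :&: Q :^ d) else [set None].
Let restr (f : coind H to) : {ffun gT -> option T} :=
  [ffun d => if d \in D then Some (ev f d) else None].

(** A function f fixed by Q satisfies f (q d k) = f d . k, so it is determined by
its values at the representatives d, and f d may be any point fixed by the k in
K with q d k = d for some q in Q.  Restriction to the representatives is thus a
bijection onto a product of sets of fixed points; the value None marks the
elements that are not representatives. *)
Lemma restr_inj : {in 'Fix_(coind_action H to)(Q) &, injective restr}.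
Proof.
move=> f g fQ gQ efg; apply/val_inj/ffunP=> u; rewrite -[u]sgvalK.
have [q [k [Qq Kk ->]]] := dc_repP Q (sgval u).
have Hd := dc_rep_in sQH (subgP u).
rewrite -!/(ev _ _) !coind_fixed_rep //.
have := congr1 (fun t : {ffun _ -> _} => t (dc_rep Q (sgval u))) efg.
by rewrite !ffunE imset_f ?subgP // => -[->].
Qed.

Lemma restr_family f : f \in 'Fix_(coind_action H to)(Q) ->
  restr f \in family (fun d => mem (F d)).
Proof.
move=> fQ; apply/familyP=> d; rewrite ffunE /F; case: ifP; last by rewrite set11.
move=> /imsetP[x Hx ->]; have Hd := dc_rep_in sQH Hx.
apply: imset_f; apply/afixP=> k /setIP[Kk]; rewrite mem_conjg => Qk.
rewrite -(coind_evM f) // conjgCV.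
exact: (coind_ev_fixed f fQ).
Qed.

Lemma restr_onto t : t \in family (fun d => mem (F d)) ->
  exists2 f, f \in 'Fix_(coind_action H to)(Q) & t = restr f.
Proof.
move=> /familyP tF.
have tD d : d \in D -> exists2 z, z \in 'Fix_to(K :&: Q :^ d) & t d = Some z.
  by move=> Dd; have := tF d; rewrite /F Dd => /imsetP.
have Drep x : x \in H -> dc_rep Q x \in D by move=> Hx; apply: imset_f.
have [z0 _ _] := tD _ (Drep 1 (group1 H)).
pose tau d := odflt z0 (t d).
have tauE d : d \in D -> t d = Some (tau d) /\ tau d \in 'Fix_to(K :&: Q :^ d).
  by move=> /tD[z zQ]; rewrite /tau => ->.
pose dec x := [pick p : gT * gT | [&& p.1 \in Q, p.2 \in K &
                                     x == p.1 * dc_rep Q x * p.2]].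
pose g x := to (tau (dc_rep Q x)) (odflt (1, 1) (dec x)).2.
have gE x q k : x \in H -> q \in Q -> k \in K -> x = q * dc_rep Q x * k ->
    g x = to (tau (dc_rep Q x)) k.
  move=> Hx Qq Kk xE; rewrite /g /dec; set d := dc_rep Q x in xE *.
  case: pickP => [[q' k'] /= /and3P[Qq' Kk' /eqP x'E] | /(_ (q, k))]; last first.
    by rewrite /= Qq Kk -xE eqxx.
  have [_ /afixP tauQ] := tauE d (Drep x Hx).
  (* Two ways of writing x in Q d K differ by an element that fixes tau d. *)
  have tau_k : to (tau d) (k * k'^-1) = tau d.
    apply: tauQ; rewrite in_setI groupM ?groupV //= mem_conjg.
    have -> : (k * k'^-1) ^ d^-1 = q^-1 * q'.
      apply: (mulgI q); apply: (mulIg (d * k')).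
      rewrite mulKVg [RHS]mulgA -x'E.
      by rewrite conjgE invgK !mulgA !mulgKV -xE.
    by rewrite groupM ?groupV.
  by rewrite -{1}tau_k -actMin ?groupM ?groupV // mulgKV.
have gM x q k : x \in H -> q \in Q -> k \in K -> g (q * x * k) = to (g x) k.
  move=> Hx Qq Kk; have [q1 [k1 [Qq1 Kk1 xE]]] := dc_repP Q x.
  rewrite (gE x q1 k1) // (gE (q * x * k) (q * q1) (k1 * k)) ?groupM //.
  - by rewrite dc_repM // actMin.
  - exact: (subsetP sQH).
  - exact: (subsetP sKH).
  - by rewrite dc_repM // {1}xE !mulgA.
have gK : equivariant to [ffun u : subg_of H => g (sgval u)].
  apply/forallP=> u; apply/forall_inP=> k Kk; rewrite !ffunE.
  have -> : sgval (u * subg H k) = 1 * sgval u * k.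
    rewrite sgvalM ?in_setT // mul1g; congr (_ * _).
    by apply: subgK; apply: (subsetP sKH).
  by rewrite gM ?subgP.
pose f : coind H to := Sub _ gK.
have fE x : x \in H -> ev f x = g x by move=> Hx; rewrite /ev /= ffunE; congr g; apply: subgK.
exists f.
  apply/coind_ev_fixed=> q x Qq Hx; rewrite !fE ?groupM ?(subsetP sQH q) //.
  by rewrite -[q * x]mulg1 gM // act1.
apply/ffunP=> d; rewrite ffunE; case: ifP => Dd; last first.
  by have := tF d; rewrite /F Dd => /set1P.
have [-> _] := tauE d Dd; case/imsetP: Dd => x Hx ->.
have Hd := dc_rep_in sQH Hx.
by rewrite fE // (gE _ 1 1) ?group1 ?dc_rep_id ?mul1g ?mulg1 // act1.
Qed.

Lemma card_fix_coind :
  #|'Fix_(coind_action H to)(Q)| = (\prod_(d in D) #|'Fix_to(K :&: Q :^ d)%g|)%N.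
Proof.
rewrite -(card_in_imset restr_inj).
have -> : #|restr @: 'Fix_(coind_action H to)(Q)| = #|family (fun d => mem (F d))|.
  apply: eq_card => t; apply/imsetP/idP => [[f fQ ->] | /restr_onto[f fQ ->]].
    exact: restr_family.
  by exists f.
rewrite card_family foldrE big_image /= [RHS]big_mkcond /=; apply: eq_bigr => d _.
rewrite /F; case: ifP => _; last exact: cards1.
by apply: card_imset => ? ? [].
Qed.
End CoinducedFixedPoints.
End DoubleCosets.

(** * The norm and its marks *)

Section NormMarks.
Variables (gT : finGroupType) (K H : {group gT}).
Hypothesis sKH : K \subset H.
Implicit Types (Q : {group gT}) (a b : burnside K).
Local Open Scope ring_scope.

(** The double coset formula for the mark at Q of the norm of a.  It makes sense
for virtual a before the norm of a is constructed. *)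
Definition norm_mark Q a : int :=
  \prod_(d in dc_reps K H Q) mark (K :&: Q :^ d)%G a.

Lemma norm_mark_bclass (T : finType) (to : action K T) Q : Q \subset H ->
  norm_mark Q (bclass to) = mark Q (bclass (coind_action H to)).
Proof.
move=> sQH; rewrite mark_bclass // card_fix_coind //.
rewrite (big_morph Posz PoszM (erefl _)); apply: eq_bigr => d _.
by rewrite mark_bclass // subsetIl.
Qed.

Lemma togroth_bclass (x : hclass K) : togroth x = bclass (hclass_act x).
Proof. by rewrite /bclass hclass_actK. Qed.

Lemma norm_markM Q : {morph norm_mark Q : a b / a * b}.
Proof.
move=> a b; rewrite -big_split; apply: eq_bigr => d _.
by rewrite markM // subsetIl.
Qed.

Lemma norm_mark1 Q : norm_mark Q 1 = 1.
Proof. by apply: big1 => d _; rewrite mark1 // subsetIl. Qed.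

Lemma norm_mark_degree Q : degree_lt #|gT|.+1 (norm_mark Q).
Proof.
have := @degree_lt_prod _ _ (enum (dc_reps K H Q))
  (fun d a => mark (K :&: Q :^ d)%G a) _.
rewrite -cardE => deg.
apply: (@degree_lt_le _ #|dc_reps K H Q|.+1); first by rewrite ltnS max_card.
have -> : norm_mark Q = fun a =>
    \prod_(d <- enum (dc_reps K H Q)) mark (K :&: Q :^ d)%G a.
  by apply/funext=> a; rewrite big_enum.
by apply: deg => d a b; rewrite markD // subsetIl.
Qed.

(** For actual K-sets this is the invariance of marks of the coinduced set; it
extends to virtual sets by polynomiality, which avoids comparing two systems of
double coset representatives. *)
Lemma norm_markJ Q a h : Q \subset H -> h \in H ->
  norm_mark (Q :^ h)%G a = norm_mark Q a.
Proof.
move=> sQH Hh; apply/eqP; rewrite -subr_eq0 -mulN1r; apply/eqP.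
apply: (degree_lt_groth (f := fun a => norm_mark _ a + -1 * norm_mark Q a)).
  exact: degree_lt_lin (norm_mark_degree _) (norm_mark_degree _).
move=> x; rewrite togroth_bclass !norm_mark_bclass ?conj_subG //.
by rewrite mark_conj // mulN1r subrr.
Qed.

Lemma norm_mark_mod Q a b (m : nat) :
  (m%:Z %| norm_mark Q (a + b *+ m) - norm_mark Q a)%Z.
Proof.
rewrite /norm_mark; apply: (big_ind2 (fun u v : int => (m%:Z %| u - v)%Z)).
- by rewrite subrr dvdz0.
- move=> u v u' v' duv duv'.
  have -> : u * u' - v * v' = (u - v) * u' + v * (u' - v') by ring.
  by apply: rpredD; [apply: dvdz_mulr | apply: dvdz_mull].
- move=> d _; rewrite markD ?subsetIl // mark_mulrn ?subsetIl //.
  by rewrite addrAC subrr add0r dvdz_mulr.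
Qed.

(** Modulo #|H| the virtual set x - y can be replaced by the actual set
x + (#|H| - 1) y, whose coinduction satisfies the congruences. *)
Lemma norm_mark_realize a :
  exists b : burnside H, forall Q, Q \subset H -> mark Q b = norm_mark Q a.
Proof.
apply: mark_realize => [Q h sQH Hh | Q sQH]; first exact: norm_markJ.
elim/gdiffW: a => x y.
have [a' aE] : exists x', gdiff x y + togroth y *+ #|H| = togroth x'.
  exists (x + y *+ #|H|.-1).
  rewrite -(prednK (cardG_gt0 H)) mulrS addrA.
  have -> : gdiff x y + togroth y = togroth x.
    by rewrite -[LHS]/(gadd _ _) gaddE; apply/gdiffP; exists 0; rewrite !addr0 addrC.
  elim: #|H|.-1 => [|n IHn]; first by rewrite !mulr0n !addr0.
  rewrite !mulrSr !addrA IHn -[LHS]/(gadd _ _) gaddE addr0 //.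
have sYH h : h \in 'N_H(Q)%g -> (Q <*> <[h]>)%G \subset H.
  by case/setIP=> Hh _; rewrite join_subG sQH cycle_subG.
rewrite -[X in (_ %| X)%Z](subKr
  (\sum_(h in 'N_H(Q)%g) norm_mark (Q <*> <[h]>)%G (togroth a'))).
apply: rpredB.
  rewrite togroth_bclass (eq_bigr _ (fun h Nh => norm_mark_bclass _ (sYH h Nh))).
  exact: mark_congruence.
rewrite -sumrB; apply: rpred_sum => h _; rewrite -aE.
apply: dvdz_trans (norm_mark_mod _ _ _ _).
by rewrite dvdzE /= cardSg ?subsetIl.
Qed.

(** Elements with the prescribed marks define a norm: since marks separate
elements, multiplicativity and polynomiality can be checked on marks, where they
hold for products of additive and multiplicative functions. *)
Lemma norm_is_norm : is_norm (norm H : burnside K -> burnside H).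
Proof.
apply: (xgetPex _ (P := @is_norm _ K H)).
have [N NE] := choice norm_mark_realize.
exists N; split.
- split; first by apply: mark_inj => Q sQH; rewrite NE // norm_mark1 mark1.
  by move=> a b; apply: mark_inj => Q sQH; rewrite markM // !NE // norm_markM.
- exists #|gT|.+1 => s sn a; apply: mark_inj => Q sQH.
  rewrite mark0 // -(foldr_deviation_comp _ _ _ (markB sQH)).
  have -> : (fun a => mark Q (N a)) = norm_mark Q by apply/funext=> b; apply: NE.
  exact: norm_mark_degree.
- move=> T to; apply: mark_inj => Q sQH; rewrite NE //.
  exact: norm_mark_bclass.
Qed.

(** Both sides are polynomial in a and agree on actual K-sets. *)
Lemma mark_norm Q a : Q \subset H -> mark Q (norm H a) = norm_mark Q a.
Proof.
move=> sQH; have [_ [n deg] Neff] := norm_is_norm.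
apply/eqP; rewrite -subr_eq0 -mulN1r; apply/eqP.
apply: (degree_lt_groth (n := maxn n #|gT|.+1)
         (f := fun a => mark Q (norm H a) + -1 * norm_mark Q a)).
  apply: degree_lt_lin.
    apply: degree_lt_le (leq_maxl _ _) _; apply: degree_lt_comp deg.
    exact: markB.
  exact: degree_lt_le (leq_maxr _ _) (norm_mark_degree Q).
move=> x; rewrite togroth_bclass Neff norm_mark_bclass //.
by rewrite mulN1r subrr.
Qed.
End NormMarks.

(** * Monoid maps between localizations *)

Section LocalizedMonoidMaps.
Variables (A B : comPzRingType) (s : A) (t : B) (N : A -> B).
Hypothesis N_morph : GRing.monoid_morphism N.
Local Open Scope ring_scope.

(** Since N s becomes 1 once t is inverted, a / s^m can be sent to N a. *)
Lemma loc_monoid_ext : N s * t = t ->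
  exists Nt : loc s -> loc t, GRing.monoid_morphism Nt /\
    forall a, Nt (toloc s a) = toloc t (N a).
Proof.
move=> Nst; have [N1 NM] := N_morph.
have NXt n : N (s ^+ n) * t = t.
  by elim: n => [|n IHn]; rewrite ?N1 ?mul1r // exprS NM -mulrA IHn.
pose Nt (u : loc s) := toloc t (N (generic_quotient.repr u).1).
have NtE a m : Nt (lfrac s a m) = toloc t (N a).
  have /lfracP[k] := lfrac_repr (lfrac s a m).
  rewrite /Nt; move: (generic_quotient.repr _) => [b n] /= /(congr1 N).
  rewrite !NM => /(congr1 ( *%R^~ t)).
  rewrite mulrAC NXt [RHS]mulrAC NXt => e.
  by apply/lfracP; exists 1; rewrite addn0.
exists Nt; split; last by move=> a; apply: NtE.
split; first by rewrite [LHS]NtE N1.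
elim/lfracW=> a m; elim/lfracW=> b n.
rewrite -[X in Nt X]/(lmul _ _) lmulE !NtE NM.
by rewrite -[RHS]/(lmul _ _) lmulE.
Qed.

(** The conclusion says that N s becomes a unit in the localization at t. *)
Lemma loc_monoid_ext_unit (Nt : loc s -> loc t) :
    GRing.monoid_morphism Nt -> (forall a, Nt (toloc s a) = toloc t (N a)) ->
  exists c k m, t ^+ k * (N s * c) = t ^+ m.
Proof.
move=> [Nt1 NtM] NtE.
have ss : toloc s s * lfrac s 1 1 = 1.
  rewrite -[LHS]/(lmul _ _) lmulE mulr1; apply/lfracP; exists 0%N.
  by rewrite mulr1 expr0 mul1r expr1.
move: (congr1 Nt ss); rewrite NtM Nt1 NtE.
elim/lfracW: (Nt _) => c m; rewrite -[LHS]/(lmul _ _) lmulE.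
case/lfracP=> k e; exists c, k, (k + m)%N.
by move: e; rewrite addn0 add0n mulr1.
Qed.
End LocalizedMonoidMaps.

(** * Normality and inherited norms *)

Section Main.
Variables (gT : finGroupType) (G L : {group gT}).
Hypothesis perfL : perfect L.
Local Open Scope ring_scope.

Let OL : Osolv L = L := eqP perfL.

Lemma mark_res_dress (K Q : {group gT}) (sKG : K \subset G) : Q \subset K ->
  mark Q (res sKG (dress_idem G L)) = (Osolv Q \in (L :^: G)%g)%:R.
Proof.
by move=> sQK; rewrite mark_res // dress_idemP // (subset_trans sQK).
Qed.

(** Where the idempotent has mark 1 at Q, the solvable residual of Q is L, and all
the groups K :&: Q :^ d lie between L and Q :^ d, hence have the same residual
L. *)
Lemma normal_inherits (K H : {group gT}) (sKH : K \subset H) (sHG : H \subset G) :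
  (L <| G)%g -> L \subset K -> inherits_norm L sKH sHG.
Proof.
move=> nLG sLK.
have LJ h : h \in G -> (L :^ h)%g = L by move=> Gh; apply: normsP (normal_norm nLG) h Gh.
have [N_morph _ _] := norm_is_norm sKH.
apply: loc_monoid_ext => //; apply: mark_inj => Q sQH.
rewrite markM // mark_norm // [mark Q (res _ _)]mark_res_dress //.
case: imsetP => [[g Gg OQ]|_]; last by rewrite mulr0.
rewrite mulr1; apply: big1 => d Dd; rewrite mark_res_dress ?subsetIl //.
have Gd : d \in G.
  by apply: (subsetP sHG); case/imsetP: Dd => x Hx ->; apply: dc_rep_in.
rewrite LJ // in OQ; have OQd : Osolv (Q :^ d)%G = L by rewrite OsolvJ OQ LJ.
rewrite (@Osolv_between _ _ (Q :^ d)%G) ?subsetIr ?OQd //.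
  by rewrite -[X in X \in _](conjsg1 L) imset_f.
by rewrite subsetI sLK -{1}OQd Osolv_sub.
Qed.

(** The norm of the idempotent from L to G has nonzero mark at L, so each factor
of this mark is nonzero: the solvable residual of L :&: L :^ d is a conjugate of
L, which forces L :^ d = L. *)
Lemma inherits_normal (sLG : L \subset G) :
  inherits_norm L sLG (subxx G) -> (L <| G)%g.
Proof.
case=> Nt [Nt_morph NtE].
have [c [k [m]]] := loc_monoid_ext_unit Nt_morph NtE.
move/(congr1 (mark L)); rewrite !(markM, mark_expr) //.
rewrite mark_res_dress // OL -[X in X \in _](conjsg1 L) imset_f ?group1 //.
rewrite !expr1n mul1r mark_norm // => NL.
have LJ d : d \in dc_reps L G L -> (L :^ d)%g = L.
  move=> Dd; apply/eqP; rewrite eq_sym eqEcard cardJg leqnn andbT.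
  have : norm_mark G L (res (subset_trans sLG (subxx G)) (dress_idem G L)) != 0.
    by apply: contra_eq_neq NL => ->; rewrite mul0r eq_sym oner_neq0.
  rewrite /norm_mark (bigD1 d) //= mulf_eq0 negb_or => /andP[+ _].
  rewrite mark_res_dress ?subsetIl //; case: imsetP => // -[g Gg Og] _.
  have sLd : Osolv (L :&: L :^ d)%G \subset L :&: L :^ d := Osolv_sub _.
  have eL : L :&: L :^ d = L.
    apply/eqP; rewrite eqEcard subsetIl -(cardJg L g) -Og.
    exact: subset_leq_card.
  by rewrite -{1}eL subsetIr.
rewrite /normal sLG; apply/normsP=> x Gx.
have [q [l [Lq Ll ->]]] := dc_repP L L x.
by rewrite !conjsgM (conjGid Lq) LJ ?imset_f // conjGid.
Qed.
End Main.

Theorem corollaryB (gT : finGroupType) (G L : {group gT}) :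
  L \subset G -> perfect L ->
  ((L <| G)%g <->
   forall (K H : {group gT}) (sKH : K \subset H) (sHG : H \subset G),
     (exists2 g, g \in G & (L :^ g)%g \subset K) ->
     inherits_norm L sKH sHG).
Proof.
move=> sLG perfL; split=> [nLG K H sKH sHG [g Gg sLK] | inh].
  apply: normal_inherits => //.
  by rewrite -(normsP (normal_norm nLG) g Gg).
apply: (@inherits_normal _ _ _ perfL sLG); apply: inh.
by exists 1%g; rewrite ?group1 ?conjsg1.
Qed.
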